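(* Let $I\in\mathbb{S}$ and let $P(x)=\sum_\ell x^\ell a_\ell$ be a nonzero slice regular polynomial with all $a_\ell\in\mathbb{C}_I$. Then \[\lim_{n\to+\infty}\frac1n m_{\mathbb{H}}(P^{\ast n})=\frac2\pi\int_0^\pi\log\max\{|P(e^{I\theta})|,|P(e^{-I\theta})|\}\sin^2\theta\,d\theta,\] and \[\lim_{m\to+\infty}\frac{1}{-m}\, m_{\mathbb{H}}(P^{\ast(-m)})=\frac2\pi\int_0^\pi\log\min\{|P(e^{I\theta})|,|P(e^{-I\theta})|\}\sin^2\theta\,d\theta,\] where $P^{\ast(-m)}(x):=(P^s(x))^{-m}\,(P^c)^{\ast m}(x)$ (defined off the zero set of $P^s$).
   Context: $\mathbb{H}$ denotes the quaternions, $\mathbb{S}$ the sphere of unit imaginary quaternions, $\mathbb{C}_I=\mathbb{R}+\mathbb{R}I$, $e^{I\theta}=\cos\theta+I\sin\theta$. $m_{\mathbb{H}}(F)=\int_{|x|=1}\log|F(x)|\,d\mu$ with $\mu$ the probability Haar measure on unit quaternions. For slice regular polynomials $P=\sum x^\ell a_\ell$, $Q=\sum x^\ell b_\ell$ (coefficients on the right), $(P\ast Q)(x)=\sum_n x^n\sum_{l=0}^na_lb_{n-l}$; $P^{\ast n}$ is the $n$-fold $\ast$-power; $P^c=\sum x^\ell\overline{a_\ell}$; $P^s=P\ast P^c$ (a polynomial with real coefficients). *)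

(* Defs.v *)
From HB Require Import structures.
From mathcomp Require Import all_boot all_order all_algebra.
From mathcomp Require Import all_classical all_reals all_analysis.
Set Implicit Arguments. Unset Strict Implicit. Unset Printing Implicit Defensive.
Import Order.TTheory GRing.Theory Num.Theory.
Local Open Scope ring_scope.
Local Open Scope classical_set_scope.

Section Quat.
Variable R : realType.

Record quat := Quat { q0 : R; q1 : R; q2 : R; q3 : R }.

Definition qzero : quat := Quat 0 0 0 0.
Definition qone : quat := Quat 1 0 0 0.
Definition qreal (r : R) : quat := Quat r 0 0 0.
Definition qadd (p q : quat) : quat :=
  Quat (q0 p + q0 q) (q1 p + q1 q) (q2 p + q2 q) (q3 p + q3 q).
Definition qscale (r : R) (q : quat) : quat :=
  Quat (r * q0 q) (r * q1 q) (r * q2 q) (r * q3 q).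
Definition qmul (p q : quat) : quat :=
  Quat (q0 p * q0 q - q1 p * q1 q - q2 p * q2 q - q3 p * q3 q)
       (q0 p * q1 q + q1 p * q0 q + q2 p * q3 q - q3 p * q2 q)
       (q0 p * q2 q - q1 p * q3 q + q2 p * q0 q + q3 p * q1 q)
       (q0 p * q3 q + q1 p * q2 q - q2 p * q1 q + q3 p * q0 q).
Definition qconj (q : quat) : quat := Quat (q0 q) (- q1 q) (- q2 q) (- q3 q).
Definition qnorm2 (q : quat) : R := q0 q ^+ 2 + q1 q ^+ 2 + q2 q ^+ 2 + q3 q ^+ 2.
Definition qabs (q : quat) : R := Num.sqrt (qnorm2 q).
(** inverse q^-1 = conj q / |q|^2 (equal to 0 for q = 0) *)
Definition qinv (q : quat) : quat := qscale (qnorm2 q)^-1 (qconj q).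
Fixpoint qpow (q : quat) (n : nat) : quat :=
  if n is n'.+1 then qmul (qpow q n') q else qone.

Definition unit_imag (I : quat) : Prop := q0 I = 0 /\ qnorm2 I = 1.
Definition in_CI (I a : quat) : Prop := exists u v : R, a = qadd (qreal u) (qscale v I).
Definition qexpI (I : quat) (t : R) : quat := qadd (qreal (cos t)) (qscale (sin t) I).

(** Slice regular polynomials P(x) = sum_l x^l a_l, represented by the
    coefficient list [:: a_0; a_1; ...; a_d] (coefficients on the right). *)
Definition spoly := seq quat.
Definition qsum (s : seq quat) : quat := foldr qadd qzero s.
Definition coef (P : spoly) (l : nat) : quat := nth qzero P l.
Definition speval (P : spoly) (x : quat) : quat :=
  qsum [seq qmul (qpow x l) (coef P l) | l <- iota 0 (size P)].
Definition spnonzero (P : spoly) : Prop := exists l, coef P l <> qzero.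

Definition star (P Q : spoly) : spoly :=
  [seq qsum [seq qmul (coef P l) (coef Q (n - l)) | l <- iota 0 n.+1]
     | n <- iota 0 (size P + size Q)].
Fixpoint starpow (P : spoly) (n : nat) : spoly :=
  if n is n'.+1 then star (starpow P n') P else [:: qone].
Definition spconj (P : spoly) : spoly := map qconj P.
Definition spsym (P : spoly) : spoly := star P (spconj P).
(** P^{*(-m)}(x) := (P^s(x))^{-m} (P^c)^{*m}(x)   (defined off the zeros of P^s;
    at those (measure zero) points qinv returns 0) *)
Definition starpow_neg (P : spoly) (m : nat) (x : quat) : quat :=
  qmul (qinv (qpow (speval (spsym P) x) m)) (speval (starpow (spconj P) m) x).

(** Unit quaternion in hyperspherical coordinates
    (psi, th) in [0,pi]^2, phi in [0, 2 pi]. *)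
Definition hsph (psi th phi : R) : quat :=
  Quat (cos psi) (sin psi * cos th) (sin psi * sin th * cos phi)
       (sin psi * sin th * sin phi).

(** Integral against the probability Haar measure mu of the unit quaternions
    (= normalized surface measure of S^3, total area 2 pi^2), written in
    hyperspherical coordinates with volume element sin^2 psi sin th. *)
Definition haar_int (f : quat -> R) : R :=
  (2 * pi ^+ 2)^-1 *
  Rintegral (@lebesgue_measure R) `[0, pi] (fun psi =>
   Rintegral (@lebesgue_measure R) `[0, pi] (fun th =>
    Rintegral (@lebesgue_measure R) `[0, 2 * pi] (fun phi =>
      f (hsph psi th phi) * (sin psi ^+ 2 * sin th)))).

Definition mH (F : quat -> quat) : R := haar_int (fun x => ln (qabs (F x))).

End Quat.

(* Main.v *)
(** On the sphere of points cos t + J sin t (J a unit imaginary quaternion), a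
    slice regular polynomial F with coefficients in C_I satisfies
      |F(cos t + J sin t)|^2 = s |F(e^{It})|^2 + (1 - s) |F(e^{-It})|^2
    with s = (1 + <I, J>) / 2, and for such polynomials the star product
    restricts to the ordinary product on C_I.  Hence, with A = |P(e^{It})|,
    B = |P(e^{-It})| (or their inverses, for negative powers),
      |P^{*n}(x)|^2 = s A^{2n} + (1 - s) B^{2n},
    and log |P^{*n}(x)| differs from n log max(A, B) by at most
    |log (s (1 - s))|, which does not depend on n.  This error is integrable,
    uniformly in n, so the means converge at rate 1/n.

    No rotation invariance of the measure is needed: writing I_1 = cos th0,
    the weight s (1 - s) is at least sin^2(th - th0) sin^2(th + th0) / 16, where
    th is the polar angle of J.  The logarithmic singularities of log A and
    log B are treated the same way: by the fundamental theorem of algebra, and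
    because |e^{it} - z| >= |sin(t - alpha)| when z is a real multiple of
    e^{i alpha}, both moduli are bounded below on [0, pi] by a constant times a
    product of factors |t - c|. *)

Require Import Defs.
From HB Require Import structures.
From mathcomp Require Import all_boot all_order all_algebra.
From mathcomp Require Import all_classical all_reals all_analysis.
From mathcomp Require Import measurable_realfun complex ring lra.
Import Order.TTheory GRing.Theory Num.Theory numFieldNormedType.Exports.
Local Open Scope ring_scope.
Local Open Scope classical_set_scope.

(** * Integrals depending on a parameter, and comparison of integrals *)

(** Tonelli makes the integrals of the positive and negative parts of [f] measurable in the
    parameter; the difference and [fine] preserve this, also where a section is not integrable. *)
Lemma measurable_Rintegral (d1 d2 : measure_display) (T1 : measurableType d1)
    (T2 : measurableType d2) (R : realType)
    (m : {sigma_finite_measure set T2 -> \bar R}) (D : set T2)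
    (f : T1 * T2 -> R) :
  measurable D -> measurable_fun setT f ->
  measurable_fun setT (fun x => Rintegral m D (fun y => f (x, y))).
Proof.
move=> mD mf.
pose g (z : (T1 * T2)%type : measurableType _) : \bar R := ((f z)%:E * (\1_D z.2)%:E)%E.
have mg : measurable_fun setT g.
  apply: emeasurable_funM; first exact/measurable_EFinP.
  apply/measurable_EFinP.
  by apply: (measurableT_comp (measurable_indic mD)); exact: measurable_snd.
have -> : (fun x => Rintegral m D (fun y => f (x, y))) =
    (fun x => fine (fubini_F m (funepos g) x - fubini_F m (funeneg g) x)%E).
  apply/funext => x; congr fine.
  have gE y : ((fun y => (f (x, y))%:E) \_ D) y = g (x, y).
    by rewrite /g /patch /= indicE; case: (y \in D); rewrite ?mule1 ?mule0.
  rewrite integral_mkcond integralE /fubini_F; congr (_ - _)%E.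
    by apply: eq_integral => y _; rewrite !funeposE gE.
  by apply: eq_integral => y _; rewrite !funenegE gE.
apply: (measurableT_comp (fine_measurable measurableT)).
apply: emeasurable_funB; apply: measurable_fun_fubini_tonelli_F => //.
- exact: measurable_funepos.
- exact: measurable_funeneg.
Qed.

(** Since [h - g] is dominated by [K], integrability passes from [g] to [h]. The majorant is
    extended-real so that it may be infinite at logarithmic singularities. *)
Lemma Rintegral_dist_le (d : measure_display) (T : measurableType d)
    (R : realType) (mu : {measure set T -> \bar R}) (D : set T) (h g : T -> R)
    (K : T -> \bar R) :
  measurable D -> measurable_fun D h -> mu.-integrable D (EFin \o g) ->
  measurable_fun D K -> (\int[mu]_(x in D) K x < +oo)%E ->
  (forall x, D x -> (`|h x - g x|%:E <= K x)%E) ->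
  mu.-integrable D (EFin \o h) /\
  (`|Rintegral mu D h - Rintegral mu D g|%:E <= \int[mu]_(x in D) K x)%E.
Proof.
move=> mD mh ig mK Koo hgK.
have K0 x : D x -> (0 <= K x)%E.
  by move=> Dx; apply: le_trans (hgK _ Dx); rewrite lee_fin.
have mg : measurable_fun D g by apply/measurable_EFinP; case/integrableP: ig.
have ihg : mu.-integrable D (EFin \o (h \- g)).
  apply/integrableP; split; first by apply/measurable_EFinP/measurable_funB.
  apply: le_lt_trans Koo; apply: ge0_le_integral => //.
    by apply: measurableT_comp => //; apply/measurable_EFinP/measurable_funB.
have ih : mu.-integrable D (EFin \o h).
  have -> : EFin \o h = ((EFin \o (h \- g)%R) \+ (EFin \o g))%E.
    by apply/funext => x /=; rewrite -EFinD subrK.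
  exact: integrableD.
split=> //; rewrite -RintegralB// EFin_normr_Rintegral//.
apply: le_trans (le_abse_integral mu mD _) _ => /=.
  by case/integrableP : ihg.
apply: ge0_le_integral => //.
by apply/measurable_EFinP/measurableT_comp => //; exact: measurable_funB.
Qed.

(** * Logarithmic singularities *)

(** An integrable majorant of [- ln `|t - c|] which is [+oo] at [t = c], where
    [ln] takes the junk value [0]; bounds by it hold everywhere, so exceptional
    null sets never have to be discarded. *)
Definition log_sing (R : realType) (c t : R) : \bar R :=
  (\sum_(k <oo) (\1_(`[c - 2^-1 ^+ k, c + 2^-1 ^+ k]) t)%:E)%E.

Definition log_sings (R : realType) (cs : seq R) (t : R) : \bar R :=
  (\sum_(c <- cs) log_sing R c t)%E.

Section LogSing.
Variable R : realType.
Local Notation mu := (@lebesgue_measure R).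
Implicit Types (c t : R) (cs : seq R).

Lemma log_sing_ge0 c t : (0 <= log_sing R c t)%E.
Proof. by apply: nneseries_ge0 => k _ _; rewrite lee_fin. Qed.

Lemma measurable_log_sing c : measurable_fun setT (log_sing R c).
Proof.
apply: ge0_emeasurable_sum => k; first by move=> x _ _; rewrite lee_fin.
by move=> _; apply/measurable_EFinP; exact: measurable_indic.
Qed.

(** The interval of index [k] has length [2 * 2^-k], and these lengths sum to 4. *)
Lemma integral_log_sing c (D : set R) : measurable D ->
  (\int[mu]_(t in D) log_sing R c t < +oo)%E.
Proof.
move=> mD; rewrite integral_nneseries//; first last.
  by move=> k; apply/measurable_funTS/measurable_EFinP; exact: measurable_indic.
apply: le_lt_trans (ltry 4).
apply: (le_trans _ (@epsilon_trick0 R 4 xpredT _)) => //.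
apply: lee_nneseries => [k _ _|k _];
  first by apply: integral_ge0 => x _; rewrite lee_fin.
rewrite integral_indic//.
apply: le_trans (le_measure _ _ _ (@subIsetl _ _ _)) _.
- by rewrite inE; apply: measurableI.
- by rewrite inE.
have r0 : 0 < 2^-1 ^+ k :> R by rewrite exprn_gt0.
rewrite /= lebesgue_measure_itv /= lte_fin ifT; last by lra.
rewrite -EFinB lee_fin.
rewrite natrX exprS invfM -exprVn; lra.
Qed.

Lemma log_sing_ge c t n : (forall j, (j < n)%N -> `|t - c| <= 2^-1 ^+ j) ->
  (n%:R%:E <= log_sing R c t)%E.
Proof.
move=> H; apply: le_trans (nneseries_lim_ge n _) => /=; last first.
  by move=> k _; rewrite lee_fin.
rewrite sumEFin lee_fin.
have -> : n%:R = \sum_(0 <= i < n) 1 :> R by rewrite sumr_const_nat subn0.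
apply: ler_sum_nat => j /andP[_ jn]; rewrite indicE mem_set//=.
have := H _ jn; rewrite ler_norml in_itv/= => /andP[? ?]; apply/andP; split; lra.
Qed.

Lemma log_sing_center c : log_sing R c c = +oo%E.
Proof.
apply/eqyP => A A0.
have [n An] : exists n : nat, A <= n%:R.
  by exists (Num.bound A); apply/ltW/archi_boundP/ltW.
apply: (@le_trans _ _ n%:R%:E); first by rewrite lee_fin.
by apply: log_sing_ge => j _; rewrite subrr normr0 exprn_ge0.
Qed.

(** If [n] is the integer part of a positive [- ln |t - c|], then [|t - c| <= e^-j <= 2^-j] for all
    [j <= n], so at least [n + 1] of the intervals contain [t]. *)
Lemma ln_le_log_sing c t : t != c -> ((- ln `|t - c|)%:E <= log_sing R c t)%E.
Proof.
move=> tc; have u0 : 0 < `|t - c| by rewrite normr_gt0 subr_eq0.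
have [l0|l0] := leP (- ln `|t - c|) 0.
  by apply: le_trans (log_sing_ge0 c t); rewrite lee_fin.
have := truncn_itv (ltW l0); set n := Num.truncn _ => /andP[n1 n2].
apply: (@le_trans _ _ n.+1%:R%:E); first by rewrite lee_fin ltW.
apply: log_sing_ge => j jn.
have jl : j%:R <= - ln `|t - c| by apply: le_trans n1; rewrite ler_nat.
rewrite -[X in X <= _]lnK ?posrE// -[ln _]opprK expRN exprVn.
rewrite lef_pV2 ?posrE ?expR_gt0 ?exprn_gt0//.
apply: (@le_trans _ _ (expR j%:R)); last by rewrite ler_expR.
rewrite -[X in expR X]mulr1 expRM_natl lerXn2r ?nnegrE ?expR_ge0//.
by have := expR_ge1Dx (1 : R); lra.
Qed.

Lemma log_sings_ge0 cs t : (0 <= log_sings R cs t)%E.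
Proof. by apply: sume_ge0 => c _; exact: log_sing_ge0. Qed.

Lemma measurable_log_sings cs : measurable_fun setT (log_sings R cs).
Proof. by apply: emeasurable_sum => c; exact: measurable_log_sing. Qed.

Lemma integral_log_sings cs (D : set R) : measurable D ->
  (\int[mu]_(t in D) log_sings R cs t < +oo)%E.
Proof.
move=> mD; rewrite ge0_integral_sum//.
- by apply: lte_sum_pinfty => c _; exact: integral_log_sing.
- by move=> c; apply: measurable_funTS; exact: measurable_log_sing.
- by move=> c t _; exact: log_sing_ge0.
Qed.

(** Splitting on whether [t] is one of the [cs] gives a statement valid at every [t] instead of
    almost everywhere. *)
Lemma ln_prod_le_log_sings cs t :
  (0 < \prod_(c <- cs) `|t - c| /\
   ((- ln (\prod_(c <- cs) `|t - c|))%:E <= log_sings R cs t)%E) \/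
  log_sings R cs t = +oo%E.
Proof.
elim: cs => [|c cs IH].
  by left; rewrite /log_sings !big_nil ln1 oppr0.
rewrite /log_sings !big_cons -/(log_sings R cs t).
have [->|tc] := eqVneq t c.
  right; rewrite log_sing_center addye// gt_eqF//.
  exact: lt_le_trans (log_sings_ge0 _ _).
have u0 : 0 < `|t - c| by rewrite normr_gt0 subr_eq0.
case: IH => [[p0 pS]|->]; last first.
  right; rewrite addey// gt_eqF//.
  exact: lt_le_trans (log_sing_ge0 _ _).
left; split; first by rewrite mulr_gt0.
rewrite lnM ?posrE// opprD EFinD leeD//; exact: ln_le_log_sing.
Qed.

Lemma norm_ln_le_log_sings cs t k B h :
  0 < k -> k * \prod_(c <- cs) `|t - c| <= h <= B ->
  (0 < h /\ (`|ln h|%:E <= (`|ln k| + `|ln B|)%:E + log_sings R cs t)%E) \/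
  log_sings R cs t = +oo%E.
Proof.
move=> k0 /andP[kh hB].
case: (ln_prod_le_log_sings cs t) => [[p0 pS]|->]; [left|by right].
have kp0 : 0 < k * \prod_(c <- cs) `|t - c| by rewrite mulr_gt0.
have h0 : 0 < h := lt_le_trans kp0 kh.
have B0 : 0 < B := lt_le_trans h0 hB.
split=> //.
have l1 : ln k + ln (\prod_(c <- cs) `|t - c|) <= ln h.
  by rewrite -lnM ?posrE// ler_ln ?posrE.
have l2 : ln h <= ln B by rewrite ler_ln ?posrE.
have := log_sings_ge0 cs t; move: pS.
case: (log_sings R cs t) => [s| |] //; rewrite ?lee_fin; last first.
  by move=> _ _; rewrite addey// leey.
move=> ps s0; rewrite ler_norml.
have := ler_norm (ln B); have := ler_norm (- ln k); rewrite normrN.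
have := normr_ge0 (ln k); have := normr_ge0 (ln B).
by move=> *; apply/andP; split; lra.
Qed.

End LogSing.

Lemma cvg_mean_of_bounded (R : realType) (u : nat -> R) (X C : R) :
  (forall n, `|u n - n%:R * X| <= C) -> (fun n => n%:R^-1 * u n) @ \oo --> X.
Proof.
move=> H; apply/cvgrPdist_le => e e0; near=> n.
have n0 : 0 < n%:R :> R by rewrite ltr0n; near: n; exact: nbhs_infty_gt.
have -> : X - n%:R^-1 * u n = - (n%:R^-1 * (u n - n%:R * X)).
  by rewrite mulrBr mulKf ?gt_eqF// opprB.
rewrite normrN normrM normfV [`|n%:R|]gtr0_norm// ler_pdivrMl//.
apply: le_trans (H n) _; rewrite mulrC -ler_pdivrMl//; near: n.
exact: nbhs_infty_ger.
Unshelve. all: by end_near. Qed.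

(** * Haar means *)

Section HaarMean.
Variable R : realType.
Local Notation mu := (@lebesgue_measure R).
Local Notation D1 := (`[(0 : R), pi] : set R).
Local Notation D2 := (`[(0 : R), 2 * pi] : set R).

Lemma measurable_sin : measurable_fun setT (@sin R).
Proof. by apply: continuous_measurable_fun; exact: continuous_sin. Qed.

Lemma measurable_cos : measurable_fun setT (@cos R).
Proof. by apply: continuous_measurable_fun; exact: continuous_cos. Qed.

Lemma lebesgue_measure_itv0 (a : R) : 0 < a ->
  (mu : {measure set _ -> \bar R}) `[0, a] = a%:E.
Proof. by move=> a0; rewrite /= lebesgue_measure_itv /= lte_fin a0 oppr0 adde0. Qed.

Lemma integrable_bounded_itv0 (a C : R) (f : R -> R) : 0 < a ->
  measurable_fun setT f -> (forall x, `|f x| <= C) ->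
  mu.-integrable `[0, a] (EFin \o f).
Proof.
move=> a0 mf fC; apply: measurable_bounded_integrable => //.
- by rewrite lebesgue_measure_itv0// ltry.
- exact: measurable_funTS.
- by exists C; split=> [|M CM x _] //=; exact: le_trans (ltW CM).
Qed.

Lemma Rintegral_sin : Rintegral mu D1 sin = 2.
Proof.
have H : (\int[mu]_(x in D1) (sin x)%:E = 2%:E)%E.
  rewrite (@continuous_FTC2 _ sin (fun x => - cos x)) ?pi_gt0//.
  - by rewrite cospi cos0 -EFinB; congr (_%:E); ring.
  - apply: continuous_subspaceT; exact: continuous_sin.
  - split.
    + by move=> x _; apply: derivableN.
    + by apply: cvgN; apply: cvg_at_right_filter; exact: continuous_cos.
    + by apply: cvgN; apply: cvg_at_left_filter; exact: continuous_cos.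
  - by move=> x _; rewrite derive1E deriveN// derive_val opprK.
by rewrite /Rintegral H.
Qed.

Lemma sin01 (t : R) : D1 t -> 0 <= sin t <= 1.
Proof. by rewrite /= in_itv/= => t0; rewrite sin_ge0_pi// sin_le1. Qed.

Lemma integrable_mul_sin2 (L : R -> R) (K : R -> \bar R) :
  measurable_fun setT L -> measurable_fun setT K ->
  (\int[mu]_(t in D1) K t < +oo)%E ->
  (forall t, D1 t -> (`|L t|%:E <= K t)%E) ->
  mu.-integrable D1 (EFin \o (fun t => L t * sin t ^+ 2)).
Proof.
move=> mL mK iK LK.
have mLs : measurable_fun D1 (fun t => L t * sin t ^+ 2).
  apply/measurable_funTS/measurable_funM => //.
  by apply: measurable_funX; exact: measurable_sin.
apply/integrableP; split; first exact/measurable_EFinP.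
apply: le_lt_trans iK; apply: ge0_le_integral => //.
- exact/measurable_EFinP/measurableT_comp.
- exact: measurable_funTS.
- move=> t Dt /=; apply: le_trans (LK _ Dt); rewrite lee_fin normrM.
  have /andP[s0 s1] := sin01 _ Dt.
  by rewrite ler_piMr// ger0_norm ?exprn_ge0// exprn_ile1.
Qed.

Section Mean.
Variables (F : nat -> quat R -> R) (L : R -> R) (K1 K2 : R -> \bar R).
Hypothesis mF : forall n,
  measurable_fun setT (fun x : R * R * R => F n (hsph x.1.1 x.1.2 x.2)).
Hypothesis mL : measurable_fun setT L.
Hypothesis mK1 : measurable_fun setT K1.
Hypothesis mK2 : measurable_fun setT K2.
Hypothesis iK1 : (\int[mu]_(t in D1) K1 t < +oo)%E.
Hypothesis iK2 : (\int[mu]_(t in D1) K2 t < +oo)%E.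
Hypothesis K10 : forall t, (0 <= K1 t)%E.
Hypothesis K20 : forall t, (0 <= K2 t)%E.
Hypothesis LK : forall t, D1 t -> (`|L t|%:E <= K1 t)%E.
(** The error is independent of [n] and splits into a function of [psi] and a function of [th], each
    integrable in its own variable; hence its triple integral is finite and uniform in [n]. *)
Hypothesis FK : forall n psi th phi, D1 psi -> D1 th ->
  (`|F n (hsph psi th phi) - n%:R * L psi|%:E <= K1 psi + K2 th)%E.

Let w (psi th : R) := sin psi ^+ 2 * sin th.
Let F1 n psi th :=
  Rintegral mu D2 (fun phi => F n (hsph psi th phi) * w psi th).
Let F2 n psi := Rintegral mu D1 (F1 n psi).

Let mw : measurable_fun setT (fun x : R * R => w x.1 x.2).
Proof.
apply: measurable_funM.
  by apply: measurable_funX; apply: measurableT_comp => //; exact: measurable_sin.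
by apply: measurableT_comp => //; exact: measurable_sin.
Qed.

Let mFw n : measurable_fun setT
  (fun x : R * R * R => F n (hsph x.1.1 x.1.2 x.2) * w x.1.1 x.1.2).
Proof.
apply: measurable_funM; first exact: mF.
by apply: (measurableT_comp mw); exact: measurable_fst.
Qed.

Let mF1 n : measurable_fun setT (fun x : R * R => F1 n x.1 x.2).
Proof. exact: (measurable_Rintegral _ _ _ _ _ mu _ _ _ (mFw n)). Qed.

Let mF2 n : measurable_fun setT (F2 n).
Proof. exact: (measurable_Rintegral _ _ _ _ _ mu _ _ _ (mF1 n)). Qed.

Let w01 psi th : D1 psi -> D1 th -> 0 <= w psi th <= 1.
Proof.
move=> /sin01/andP[a b] /sin01/andP[c d]; apply/andP; split.
  by rewrite /w mulr_ge0// exprn_ge0.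
by rewrite /w mulr_ile1// ?exprn_ge0// exprn_ile1.
Qed.

Let pi2_gt0 : 0 < 2 * pi :> R.
Proof. by rewrite mulr_gt0// pi_gt0. Qed.

(** The variable [phi] ranges over an interval of length [2 * pi], on which the majorant is
    constant; the weight [w <= 1] is dropped from the error. *)
Let F1_bound n psi th : D1 psi -> D1 th ->
  (`|F1 n psi th - n%:R * L psi * w psi th * (2 * pi)|%:E <=
   (2 * pi)%:E * (K1 psi + K2 th))%E.
Proof.
move=> Dpsi Dth.
have := FK n psi th _ Dpsi Dth; have := adde_ge0 (K10 psi) (K20 th).
(* Where the majorant is infinite the bound is trivial; elsewhere it is a real constant. *)
case: (K1 psi + K2 th)%E => [k| |] // k0 fk; last first.
  by rewrite gt0_muley ?lte_fin// leey.
have [w0 w1] := andP (w01 _ _ Dpsi Dth).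
have := @Rintegral_dist_le _ _ R mu D2
  (fun phi => F n (hsph psi th phi) * w psi th)
  (fun=> n%:R * L psi * w psi th) (cst k%:E).
rewrite integral_cst// Rintegral_cst// lebesgue_measure_itv0//= [(k%:E * _)%E]muleC.
move=> -[] //.
- apply: measurable_funTS.
  exact: (measurableT_comp (mFw n) (pair1_measurable (psi, th))).
- exact: (integrable_bounded_itv0 _ `|n%:R * L psi * w psi th|).
- by rewrite -EFinM ltry.
move=> phi _; rewrite -mulrBl normrM (ger0_norm w0) lee_fin.
have := fk phi; rewrite lee_fin; apply: le_trans.
by rewrite ler_piMr.
Qed.

(** The integral of [sin th] over [[0, pi]] is 2, which turns the factor [2 * pi] into [4 * pi]. *)
Let F2_bound n psi : D1 psi ->
  (`|F2 n psi - n%:R * (4 * pi * (L psi * sin psi ^+ 2))|%:E <=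
   (2 * pi)%:E * (pi%:E * K1 psi + \int[mu]_(t in D1) K2 t))%E.
Proof.
move=> Dpsi.
have I0 : (0 <= \int[mu]_(t in D1) K2 t)%E by apply: integral_ge0.
have H th : D1 th -> (`|F1 n psi th - n%:R * L psi * w psi th * (2 * pi)|%:E <=
   (2 * pi)%:E * (K1 psi + K2 th))%E by exact: F1_bound.
have := K10 psi; move: H; case: (K1 psi) => [k| |] // H k0; last first.
  rewrite gt0_muley ?lte_fin ?pi_gt0// addye ?gt0_muley ?lte_fin ?leey//.
  by rewrite gt_eqF// (lt_le_trans _ I0).
have [] := @Rintegral_dist_le _ _ R mu D1 (F1 n psi)
  (fun th => n%:R * L psi * sin psi ^+ 2 * (2 * pi) * sin th)
  (fun th => (2 * pi)%:E * (k%:E + K2 th))%E.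
- by [].
- apply: measurable_funTS.
  exact: (measurableT_comp (mF1 n) (pair1_measurable psi)).
- apply: (integrable_bounded_itv0 _ `|n%:R * L psi * sin psi ^+ 2 * (2 * pi)|).
  + exact: pi_gt0.
  + by apply: measurable_funM => //; exact: measurable_sin.
  + by move=> x; rewrite normrM ler_piMr// ler_norml sin_geN1 sin_le1.
- apply: measurable_funTS; apply: measurable_funeM.
  by apply: emeasurable_funD.
- rewrite ge0_integralZl_EFin//; last 3 first.
  + by move=> x _; rewrite adde_ge0.
  + by apply: measurable_funTS; apply: emeasurable_funD.
  + exact: ltW.
  rewrite ge0_integralD//; last exact: measurable_funTS.
  rewrite integral_cst// lebesgue_measure_itv0 ?pi_gt0//.
  by rewrite lte_mul_pinfty// ?lee_fin ?ltW// lte_add_pinfty// -EFinM ltry.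
- move=> th Dth; have := H _ Dth; congr (_ <= _)%E; congr (`|_|%:E).
  by rewrite /w; ring.
move=> _; rewrite RintegralZl//; last first.
  apply: (integrable_bounded_itv0 _ 1) => //; [exact: pi_gt0|exact: measurable_sin|].
  by move=> x; rewrite ler_norml sin_geN1 sin_le1.
rewrite Rintegral_sin ge0_integralZl_EFin//; last 3 first.
- by move=> x _; rewrite adde_ge0.
- by apply: measurable_funTS; apply: emeasurable_funD.
- exact: ltW.
rewrite ge0_integralD//; last exact: measurable_funTS.
rewrite integral_cst// lebesgue_measure_itv0 ?pi_gt0// [(k%:E * _)%E]muleC.
by congr (_ <= _)%E; congr (`|_|%:E); rewrite -/(F2 n psi); ring.
Qed.

(** Integrating the previous bound over [psi] leaves a constant error [C], and dividing [4 * pi] by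
    the area [2 * pi^2] of the sphere gives the factor [2 / pi]. *)
Lemma haar_int_mean :
  (fun n => n%:R^-1 * haar_int (F n)) @ \oo -->
  2 / pi * Rintegral mu D1 (fun t => L t * sin t ^+ 2).
Proof.
have pi0 := pi_gt0 R.
have I0 : (0 <= \int[mu]_(t in D1) K2 t)%E by apply: integral_ge0.
have iLs := integrable_mul_sin2 _ _ mL mK1 iK1 LK.
pose C := fine (\int[mu]_(psi in D1)
  ((2 * pi)%:E * (pi%:E * K1 psi + \int[mu]_(t in D1) K2 t)))%E.
have mK : measurable_fun D1
    (fun psi => (2 * pi)%:E * (pi%:E * K1 psi + \int[mu]_(t in D1) K2 t))%E.
  apply: measurable_funTS; apply: measurable_funeM.
  by apply: emeasurable_funD => //; apply: measurable_funeM.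
have iK : (\int[mu]_(psi in D1)
    ((2 * pi)%:E * (pi%:E * K1 psi + \int[mu]_(t in D1) K2 t)) < +oo)%E.
  rewrite ge0_integralZl_EFin//; last 3 first.
  - by move=> x _; rewrite adde_ge0// mule_ge0// lee_fin ltW.
  - apply: measurable_funTS; apply: emeasurable_funD => //.
    exact: measurable_funeM.
  - exact: ltW.
  rewrite ge0_integralD//; last 2 first.
  - by move=> x _; rewrite mule_ge0// lee_fin ltW.
  - by apply: measurable_funTS; exact: measurable_funeM.
  rewrite ge0_integralZl_EFin//; last 2 first.
  - exact: measurable_funTS.
  - exact: ltW.
  rewrite integral_cst// lebesgue_measure_itv0//.
  rewrite lte_mul_pinfty// ?lee_fin ?ltW// lte_add_pinfty//.
    by rewrite lte_mul_pinfty// lee_fin ltW.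
  by rewrite muleC lte_mul_pinfty// lee_fin ltW.
have key n : `|Rintegral mu D1 (F2 n) -
    n%:R * (4 * pi * Rintegral mu D1 (fun t => L t * sin t ^+ 2))| <= C.
  have iLs' : mu.-integrable D1 (EFin \o (fun t => 4 * pi * (L t * sin t ^+ 2))).
    exact: (integrableZl _ (4 * pi) iLs).
  rewrite -RintegralZl// -RintegralZl//.
  rewrite -lee_fin fineK; last first.
    rewrite ge0_fin_numE//; apply: integral_ge0 => x _.
    apply: mule_ge0; first by rewrite lee_fin ltW.
    by rewrite adde_ge0// mule_ge0// lee_fin ltW.
  have [] := @Rintegral_dist_le _ _ R mu D1 (F2 n)
    (fun t => n%:R * (4 * pi * (L t * sin t ^+ 2))) _
    _ (measurable_funTS (mF2 n)) _ mK iK (F2_bound n) => //.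
  exact: (integrableZl _ n%:R iLs').
apply: (@cvg_mean_of_bounded _ _ _ ((2 * pi ^+ 2)^-1 * C)) => n.
rewrite /haar_int -/(F2 n).
set J := Rintegral mu D1 (fun t => L t * sin t ^+ 2).
have -> : n%:R * (2 / pi * J) = (2 * pi ^+ 2)^-1 * (n%:R * (4 * pi * J)).
  by move: pi pi0 J => p p0 J; field; rewrite gt_eqF.
have c0 : 0 < (2 * pi ^+ 2)^-1 :> R by rewrite invr_gt0 mulr_gt0// exprn_gt0.
rewrite -mulrBr normrM (gtr0_norm c0) ler_pM2l//; exact: key.
Qed.

End Mean.
End HaarMean.

(** * Lower bounds for polynomials on the unit circle *)

Section CircleBounds.
Variable R : realType.
Implicit Types (t u v alpha : R) (h g : R -> R) (z : R[i]) (p : {poly R[i]}).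
Local Notation D1 := (`[(0 : R), pi] : set R).

(** With [y = v / 2], the mean value theorem gives [sin y >= y cos y], so [sin v = 2 sin y cos y >=
    2 y (cos y)^2 = y (1 + cos v) >= y]. *)
Lemma sin_ge_half v : 0 <= v <= pi / 2 -> v / 2 <= sin v.
Proof.
move=> /andP[v0 vpi]; set y := v / 2.
have y0 : 0 <= y by rewrite /y; lra.
have [xi /[!in_itv]/= /andP[xi0 xiy] sE] :
    exists2 xi, xi \in `[0, y]%R & sin y - sin 0 = cos xi * (y - 0).
  apply: (@MVT_segment _ sin cos) => //.
  by apply: continuous_subspaceT; exact: continuous_sin.
rewrite sin0 !subr0 in sE.
have pi0 := pi_gt0 R.
have cy0 : 0 <= cos y by apply: cos_ge0_pihalf; rewrite /y; apply/andP; split; lra.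
have cxi : cos y <= cos xi.
  have ypi : y <= pi by rewrite /y; lra.
  have [->//|xiy'] := eqVneq xi y.
  have {}xiy : xi < y by rewrite lt_neqAle xiy'.
  by apply/ltW; rewrite ltr_cos// in_itv/= ?xi0 ?y0// (le_trans (ltW xiy)).
have c2 : 1 <= 2 * cos y ^+ 2.
  have : 0 <= cos v by apply: cos_ge0_pihalf; apply/andP; split; lra.
  have -> : v = y *+ 2 by rewrite /y mulr2n; lra.
  by rewrite cos_mulr2n mulr2n; lra.
have -> : sin v = 2 * (sin y * cos y).
  have -> : v = y *+ 2 by rewrite /y mulr2n; lra.
  by rewrite sin_mulr2n -mulr_natl [cos _ * _]mulrC.
rewrite sE -/y.
have : 0 <= y * (cos xi - cos y) * cos y by rewrite !mulr_ge0// subr_ge0.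
have : 0 <= y * (2 * cos y ^+ 2 - 1) by rewrite mulr_ge0// subr_ge0.
nra.
Qed.

(** Write [sin u = 2 sin (u / 2) cos (u / 2)] and the cosine as [sin (pi / 2 - u / 2)]; both
    arguments lie in [[0, pi / 2]], where the linear bound applies. *)
Lemma sin_ge_parabola u : 0 <= u <= pi -> u * (pi - u) / 8 <= sin u.
Proof.
move=> /andP[u0 upi].
have -> : sin u = 2 * (sin (u / 2) * sin (pi / 2 - u / 2)).
  rewrite sinB sin_pihalf cos_pihalf mul1r mul0r subr0.
  have -> : sin u = sin ((u / 2) *+ 2) by congr sin; rewrite mulr2n; lra.
  by rewrite sin_mulr2n -mulr_natl [cos _ * _]mulrC.
have h1 : u / 2 / 2 <= sin (u / 2) by apply: sin_ge_half; apply/andP; split; lra.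
have h2 : (pi / 2 - u / 2) / 2 <= sin (pi / 2 - u / 2).
  by apply: sin_ge_half; apply/andP; split; lra.
have := ler_pM _ _ h1 h2.
have -> : 0 <= u / 2 / 2 by lra.
have -> : 0 <= (pi / 2 - u / 2) / 2 by lra.
move=> /(_ isT isT); lra.
Qed.

(** As [t - alpha] ranges over [[-pi, pi]], the sine can vanish only at [-pi], [0] and [pi]. For
    [u = |t - alpha|] the parabola bound suffices, since the extra factor [u + pi] is at most
    [2 * pi]. *)
Lemma norm_sin_sub_ge alpha t : 0 <= alpha <= pi -> 0 <= t <= pi ->
  (16 * pi)^-1 * (`|t - alpha| * (`|t - (alpha - pi)| * `|t - (alpha + pi)|))
    <= `|sin (t - alpha)|.
Proof.
have pi0 := pi_gt0 R.
have key u : 0 <= u <= pi ->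
    (16 * pi)^-1 * (u * ((u + pi) * (pi - u))) <= sin u.
  move=> /andP[u0 upi]; apply: le_trans (sin_ge_parabola u _); last exact/andP.
  rewrite ler_pdivrMl ?mulr_gt0//.
  have : 0 <= u * (pi - u) * (pi - u) by rewrite !mulr_ge0// subr_ge0.
  nra.
move=> /andP[a0 api] /andP[t0 tpi].
have [at_|ta] := leP alpha t.
  rewrite (@ger0_norm _ (t - alpha)) ?subr_ge0//.
  rewrite (@ger0_norm _ (t - (alpha - pi))); last by lra.
  rewrite (@ler0_norm _ (t - (alpha + pi))); last by lra.
  apply: le_trans (ler_norm _).
  have := key (t - alpha); have -> : 0 <= t - alpha <= pi by apply/andP; split; lra.
  move=> /(_ isT); apply: le_trans; rewrite le_eqVlt; apply/orP; left.
  by apply/eqP; congr (_ * (_ * _)); ring.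
rewrite (@ltr0_norm _ (t - alpha)) ?subr_lt0//.
rewrite (@ger0_norm _ (t - (alpha - pi))); last by lra.
rewrite (@ler0_norm _ (t - (alpha + pi))); last by lra.
rewrite -normrN -sinN; apply: le_trans (ler_norm _).
have := key (- (t - alpha)).
have -> : 0 <= - (t - alpha) <= pi by apply/andP; split; lra.
move=> /(_ isT); apply: le_trans; rewrite le_eqVlt; apply/orP; left.
by apply/eqP; congr (_ * (_ * _)); ring.
Qed.

(** Zeros of finite order at finitely many points, with multiplicity recorded by repetition in [cs]:
    stable under products, and enough to make [ln (h t)] integrable. *)
Definition prod_bounded h := exists (cs : seq R) (k B : R), 0 < k /\
  forall t, D1 t -> k * \prod_(c <- cs) `|t - c| <= h t <= B.

Lemma prod_bounded_cst (a : R) : 0 < a -> prod_bounded (fun=> a).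
Proof.
by move=> a0; exists [::], a, a; split=> // t _; rewrite big_nil mulr1 lexx.
Qed.

Lemma prod_bounded_mul g h :
  prod_bounded g -> prod_bounded h -> prod_bounded (fun t => g t * h t).
Proof.
move=> [cs [k [B [k0 kB]]]] [cs' [k' [B' [k'0 kB']]]].
exists (cs ++ cs'), (k * k'), (B * B'); split=> [|t Dt]; first exact: mulr_gt0.
have p0 (s : seq R) : 0 <= \prod_(c <- s) `|t - c| by apply: prodr_ge0.
have /andP[a b] := kB t Dt; have /andP[a' b'] := kB' t Dt.
have ka0 : 0 <= k * \prod_(c <- cs) `|t - c| by rewrite mulr_ge0// ltW.
have ka0' : 0 <= k' * \prod_(c <- cs') `|t - c| by rewrite mulr_ge0// ltW.
rewrite big_cat/= mulrACA; apply/andP; split; first exact: ler_pM.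
by apply: ler_pM => //; [exact: le_trans a|exact: le_trans a'].
Qed.

Lemma prod_bounded_le g h (B : R) : prod_bounded g ->
  (forall t, D1 t -> g t <= h t <= B) -> prod_bounded h.
Proof.
move=> [cs [k [B' [k0 kB]]]] gh; exists cs, k, B; split=> // t Dt.
have /andP[a _] := kB t Dt; have /andP[b ->] := gh t Dt.
by rewrite andbT (le_trans a b).
Qed.

Lemma prod_bounded_sin alpha : 0 <= alpha <= pi ->
  prod_bounded (fun t => `|sin (t - alpha)|).
Proof.
move=> a; exists [:: alpha; alpha - pi; alpha + pi], (16 * pi)^-1, 1.
split; first by rewrite invr_gt0 mulr_gt0// pi_gt0.
move=> t; rewrite /= in_itv/= => Dt.
rewrite !big_cons big_nil mulr1 norm_sin_sub_ge//=.
by rewrite ler_norml sin_geN1 sin_le1.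
Qed.

(** [rho] may be negative: only the real line through [x + i y] matters. *)
Lemma polar_half (x y : R) : exists rho alpha : R,
  [/\ 0 <= alpha <= pi, x = rho * cos alpha & y = rho * sin alpha].
Proof.
have pi0 := pi_ge0 R.
have nonneg (a b : R) : 0 <= b -> exists rho alpha : R,
    [/\ 0 <= alpha <= pi, a = rho * cos alpha & b = rho * sin alpha].
  move=> b0; set r := Num.sqrt (a ^+ 2 + b ^+ 2).
  have r2 : r ^+ 2 = a ^+ 2 + b ^+ 2 by rewrite sqr_sqrtr// addr_ge0// sqr_ge0.
  have [r0|r0] := eqVneq r 0.
    exists 0, 0; rewrite !mul0r lexx pi0; move: r2; rewrite r0 expr0n/=.
    move/esym/eqP; rewrite paddr_eq0 ?sqr_ge0// !sqrf_eq0.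
    by move=> /andP[/eqP-> /eqP->].
  have rp : 0 < r by rewrite lt_neqAle eq_sym r0 sqrtr_ge0.
  have ar : -1 <= a / r <= 1.
    rewrite -ler_norml normrM normfV (gtr0_norm rp) ler_pdivrMr// mul1r.
    rewrite -(@ler_pXn2r _ 2)// ?nnegrE ?(ltW rp)// r2 real_normK ?num_real//.
    by rewrite lerDl sqr_ge0.
  exists r, (acos (a / r)); split.
  - by rewrite acos_ge0 ?acos_lepi.
  - by rewrite acosK ?in_itv//= mulrC divfK.
  - rewrite sin_acos//.
    have -> : 1 - (a / r) ^+ 2 = (b / r) ^+ 2.
      rewrite !expr_div_n r2; field; rewrite -r2 sqrf_eq0//.
    by rewrite sqrtr_sqr ger0_norm ?divr_ge0 ?(ltW rp)// mulrC divfK.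
(* For [y < 0] the opposite point lies in the upper half-plane, and negating [rho] returns to the
   original one. *)
have [y0|y0] := leP 0 y; first exact: nonneg.
have [rho [alpha [a e1 e2]]] := nonneg (- x) (- y) ltac:(by rewrite oppr_ge0 ltW).
by exists (- rho), alpha; split=> //; rewrite mulNr -?e1 -?e2 opprK.
Qed.

Definition expi t : R[i] := Complex (cos t) (sin t).

Lemma normc_expi t : Normc.normc (expi t) = 1.
Proof. by rewrite /= cos2Dsin2 sqrtr1. Qed.

(** For [z] on the real line through [e^{i alpha}], the distance from [e^{it}] to [z] is at least
    its distance [|sin (t - alpha)|] to that line. *)
Lemma prod_bounded_expi_sub z : prod_bounded (fun t => Normc.normc (expi t - z)).
Proof.
case: z => x y; have [rho [alpha [a ex ey]]] := polar_half x y.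
apply: (@prod_bounded_le _ _ (1 + Normc.normc (Complex x y))
  (prod_bounded_sin alpha a)).
move=> t _; apply/andP; split; last first.
  apply: (le_trans (@le_normcD R (expi t) (- Complex x y))).
  by rewrite normc_expi normcN.
rewrite -[leLHS]sqrtr_sqr /= ler_wsqrtr//.
have := cos2Dsin2 alpha; rewrite ex ey sinB => h.
set c := cos t; set s := sin t; set ca := cos alpha; set sa := sin alpha.
rewrite -/ca -/sa in h.
have -> : s * ca - c * sa = (s - rho * sa) * ca - (c - rho * ca) * sa by ring.
set A := c - rho * ca; set B := s - rho * sa.
rewrite -[leRHS]mulr1 -h.
(* The discarded square is the component of [e^{it} - z] along the line. *)
have := sqr_ge0 (A * ca + B * sa); nra.
Qed.

Lemma prod_bounded_poly p : p != 0 ->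
  prod_bounded (fun t => Normc.normc p.[expi t]).
Proof.
move=> p0; have [r ->] := closed_field_poly_normal p.
have l0 : 0 < Normc.normc (lead_coef p).
  rewrite lt_neqAle; apply/andP; split.
    apply/eqP => /esym/Normc.eq0_normc/eqP; rewrite lead_coef_eq0; exact/negP.
  by case: (lead_coef p) => ? ?; exact: sqrtr_ge0.
have -> : (fun t => Normc.normc (lead_coef p *: \prod_(z <- r) ('X - z%:P)).[expi t]) =
  (fun t => Normc.normc (lead_coef p) *
            Normc.normc (\prod_(z <- r) ('X - z%:P)).[expi t]).
  by apply/funext => t; rewrite hornerZ Normc.normcM.
apply: prod_bounded_mul; first exact: prod_bounded_cst.
elim: r => [|z r IH].
  apply: (@prod_bounded_le _ _ 1 (prod_bounded_cst 1 ltr01)) => t _.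
  by rewrite big_nil hornerC Normc.normc1 lexx.
have -> : (fun t => Normc.normc (\prod_(j <- z :: r) ('X - j%:P)).[expi t]) =
  (fun t => Normc.normc (expi t - z) *
            Normc.normc (\prod_(z <- r) ('X - z%:P)).[expi t]).
  apply/funext => t; rewrite big_cons hornerM Normc.normcM.
  by rewrite hornerD hornerN hornerX hornerC.
by apply: prod_bounded_mul => //; exact: prod_bounded_expi_sub.
Qed.

Lemma normc_conjc z : Normc.normc z^*%C = Normc.normc z.
Proof. by case: z => a b /=; rewrite sqrrN. Qed.

(** Conjugating the coefficients of [p] reduces this to a value at [e^{it}], with the same
    modulus. *)
Lemma prod_bounded_poly_conj p : p != 0 ->
  prod_bounded (fun t => Normc.normc p.[(expi t)^*%C]).
Proof.
move=> p0; have pc0 : map_poly (@conjc R) p != 0 by rewrite map_poly_eq0.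
have := prod_bounded_poly _ pc0; congr prod_bounded; apply/funext => t.
by rewrite -[RHS]normc_conjc -horner_map/= opprK.
Qed.

End CircleBounds.

(** * Slice regular polynomials with coefficients in C_I *)

Section Quaternions.
Variable R : realType.
Implicit Types (I J a b : quat R) (z w : R[i]) (P Q : spoly R) (p q : {poly R[i]}).

Lemma quat_eq a b : q0 a = q0 b -> q1 a = q1 b -> q2 a = q2 b -> q3 a = q3 b ->
  a = b.
Proof. by case: a b => ? ? ? ? [? ? ? ?] /= -> -> -> ->. Qed.

Lemma qnorm2_ge0 a : 0 <= qnorm2 a.
Proof. by rewrite /qnorm2 !addr_ge0// sqr_ge0. Qed.

Lemma qabs_ge0 a : 0 <= qabs a.
Proof. exact: sqrtr_ge0. Qed.

Lemma sqr_qabs a : qabs a ^+ 2 = qnorm2 a.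
Proof. by rewrite sqr_sqrtr// qnorm2_ge0. Qed.

Lemma qabs_mul a b : qabs (qmul a b) = qabs a * qabs b.
Proof.
rewrite /qabs -sqrtrM ?qnorm2_ge0//; congr Num.sqrt.
by case: a b => ? ? ? ? [? ? ? ?]; rewrite /qnorm2/=; ring.
Qed.

(** Holds at [a = 0] too, both inverses being 0 there. *)
Lemma qabs_inv a : qabs (qinv a) = (qabs a)^-1.
Proof.
rewrite /qabs -sqrtrV ?qnorm2_ge0//; congr Num.sqrt.
have -> : qnorm2 (qinv a) = (qnorm2 a)^-1 ^+ 2 * qnorm2 a.
  by rewrite /qinv; move: (qnorm2 a)^-1 => k; rewrite /qnorm2/=; ring.
have [->|n0] := eqVneq (qnorm2 a) 0; first by rewrite invr0 mulr0.
by rewrite expr2 mulfVK.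
Qed.

Lemma qabs_pow a n : qabs (qpow a n) = qabs a ^+ n.
Proof.
elim: n => [|n IH] /=; last by rewrite qabs_mul IH exprSr.
by rewrite /qabs /qnorm2 /= !expr0n !addr0 expr1n sqrtr1.
Qed.

(** The embedding of the complex numbers onto [C_I] that sends ['i] to [I]; multiplicative when [I]
    is a unit imaginary. *)
Definition qC I z : quat R := qadd (qreal (complex.Re z)) (qscale (complex.Im z) I).

Definition qdot I J : R := q1 I * q1 J + q2 I * q2 J + q3 I * q3 J.

Lemma unit_imagE I : unit_imag I -> q0 I = 0 /\ qdot I I = 1.
Proof.
move=> [I0 I1]; split=> //; move: I1; rewrite /qnorm2 /qdot I0 expr0n add0r.
by rewrite -!expr2.
Qed.

Lemma qC_mul I z w : unit_imag I -> qmul (qC I z) (qC I w) = qC I (z * w).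
Proof.
move=> /unit_imagE[]; case: I z w => i0 i1 i2 i3 [z0 z1] [w0 w1].
rewrite /qdot /= => -> N; apply: quat_eq => /=; rewrite ?mulr0 ?addr0 ?add0r; try ring.
rewrite -[z1 * w1]mulr1 -N; ring.
Qed.

Lemma qC_add I z w : qadd (qC I z) (qC I w) = qC I (z + w).
Proof.
case: I z w => i0 i1 i2 i3 [z0 z1] [w0 w1].
by apply: quat_eq => /=; ring.
Qed.

Lemma qC0 I : qC I 0 = qzero R.
Proof. by apply: quat_eq => /=; rewrite mul0r addr0. Qed.

Lemma qC1 I : qC I 1 = qone R.
Proof. by apply: quat_eq => /=; rewrite mul0r addr0. Qed.

Lemma qC_conj I z : unit_imag I -> qconj (qC I z) = qC I z^*%C.
Proof.
move=> /unit_imagE[]; case: I z => i0 i1 i2 i3 [z0 z1].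
by rewrite /qdot /= => -> _; apply: quat_eq => /=; ring.
Qed.

Lemma qC_pow I z n : unit_imag I -> qpow (qC I z) n = qC I (z ^+ n).
Proof.
by move=> uI; elim: n => [|n IH] /=; rewrite ?expr0 ?qC1// IH qC_mul// exprSr.
Qed.

Lemma qC_sum I (T : Type) (s : seq T) (f : T -> R[i]) :
  qsum [seq qC I (f l) | l <- s] = qC I (\sum_(l <- s) f l).
Proof.
elim: s => [|l s IH]; first by rewrite big_nil qC0.
by rewrite big_cons -qC_add -IH.
Qed.

Lemma qabs_qC I z : unit_imag I -> qabs (qC I z) = Normc.normc z.
Proof.
move=> /unit_imagE[]; case: I z => i0 i1 i2 i3 [z0 z1].
rewrite /qdot /qabs /qnorm2 /= => -> N; congr Num.sqrt.
by rewrite -[z1 ^+ 2]mulr1 -N; ring.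
Qed.

Lemma qC_eq0 I z : unit_imag I -> qC I z = qzero R -> z = 0.
Proof.
move=> uI z0; apply: Normc.eq0_normc; rewrite -(qabs_qC _ _ uI) z0.
by rewrite /qabs /qnorm2 /= !expr0n !addr0 sqrtr0.
Qed.

(** Quantifying over all indices makes trailing zeros in the list [P] harmless. *)
Definition represents I P p := forall l, coef P l = qC I p`_l.

Lemma represents_size I P p l : unit_imag I -> represents I P p ->
  (size P <= l)%N -> p`_l = 0.
Proof.
move=> uI PIp sl; apply: (qC_eq0 _ _ uI).
by rewrite -PIp /coef nth_default.
Qed.

(** All coefficients lie in the commutative field [C_I], where the convolution is the usual product
    of polynomials. *)
Lemma represents_star I P Q p q : unit_imag I ->
  represents I P p -> represents I Q q -> represents I (star P Q) (p * q).
Proof.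
move=> uI Pp Qq n; rewrite coefM.
have [n_lt|n_ge] := ltnP n (size P + size Q).
  rewrite /coef /star (nth_map 0%N) ?size_iota// nth_iota// add0n.
  rewrite -(big_mkord xpredT (fun j => p`_j * q`_(n - j))).
  rewrite /index_iota subn0 -qC_sum; congr qsum; apply: eq_map => l.
  by rewrite Pp Qq qC_mul.
rewrite /coef nth_default ?size_map ?size_iota// big1 ?qC0// => j _.
(* Beyond the end of the list, each term has a factor past the end of [P] or of [Q]. *)
have [jP|jP] := leqP (size P) j.
  by rewrite (represents_size _ _ _ _ uI Pp jP) mul0r.
rewrite (represents_size _ _ _ _ uI Qq) ?mulr0//.
rewrite leq_subRL; last by rewrite -ltnS ltn_ord.
by apply: leq_trans n_ge; rewrite leq_add2r ltnW.
Qed.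

Lemma represents_starpow I P p n : unit_imag I -> represents I P p ->
  represents I (starpow P n) (p ^+ n).
Proof.
move=> uI Pp; elim: n => [|n IH] /=; last first.
  by rewrite exprSr; exact: represents_star.
by move=> [|[|l]]; rewrite expr0 coef1 /coef/= ?qC1 ?qC0.
Qed.

Lemma represents_conj I P p : unit_imag I -> represents I P p ->
  represents I (spconj P) (map_poly (@conjc R) p).
Proof.
move=> uI Pp l; rewrite coef_map /= -qC_conj// -Pp /coef.
have [lP|lP] := ltnP l (size P); first by rewrite (nth_map (qzero R)).
rewrite !nth_default ?size_map//.
by apply: quat_eq => /=; rewrite ?oppr0.
Qed.

Lemma in_CI_represents I P : unit_imag I -> (forall l, in_CI I (coef P l)) ->
  exists p, represents I P p.
Proof.
move=> uI PI.
have [f fE] : exists f : nat -> R[i], forall l, coef P l = qC I (f l).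
  have /choice[f fE] l : exists z, coef P l = qC I z.
    by have [u [v ->]] := PI l; exists (Complex u v).
  by exists f.
exists (\poly_(l < size P) f l) => l; rewrite coef_poly fE.
case: ltnP => // sl; congr qC; apply: (qC_eq0 _ _ uI).
by rewrite -fE /coef nth_default.
Qed.

Lemma represents_eval I P p z : unit_imag I -> represents I P p ->
  speval P (qC I z) = qC I p.[z].
Proof.
move=> uI Pp; rewrite (@horner_coef_wide _ (size P)); last first.
  by apply/leq_sizeP => j; exact: represents_size uI Pp.
rewrite -(big_mkord xpredT (fun j => p`_j * z ^+ j)).
rewrite /index_iota subn0 -qC_sum; congr qsum; apply: eq_map => l.
by rewrite Pp qC_pow// qC_mul// mulrC.
Qed.

(** The powers of a point of [C_J] are split as [Re + J Im]; collecting terms gives [a + J b] with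
    [a], [b] in [C_I]. *)
Lemma qsum_split I J (s : seq nat) (f g : nat -> R[i]) :
  qsum [seq qmul (qC J (f l)) (qC I (g l)) | l <- s] =
  qadd (qC I (\sum_(l <- s) (complex.Re (f l))%:C%C * g l))
       (qmul J (qC I (\sum_(l <- s) (complex.Im (f l))%:C%C * g l))).
Proof.
elim: s => [|l s IH]; first by rewrite !big_nil qC0; apply: quat_eq => /=; ring.
rewrite !big_cons /= IH {IH}.
move: (\sum_(_ <- s) _) (\sum_(_ <- s) _) => [u0 u1] [v0 v1].
case: (f l) (g l) => f0 f1 [g0 g1].
by case: I J => ? ? ? ? [? ? ? ?]; apply: quat_eq => /=; ring.
Qed.

Lemma sqr_normc z : Normc.normc z ^+ 2 = complex.Re z ^+ 2 + complex.Im z ^+ 2.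
Proof. by case: z => a b /=; rewrite sqr_sqrtr// addr_ge0// sqr_ge0. Qed.

(** Both sides equal [|z|^2 + |w|^2 + 2 <I, J> (Im z Re w - Re z Im w)]; the two terms on the right
    are the values at [J = I] and [J = -I]. *)
Lemma qnorm2_split I J z w : unit_imag I -> unit_imag J ->
  qnorm2 (qadd (qC I z) (qmul J (qC I w))) =
  (1 + qdot I J) / 2 * Normc.normc (z + 'i%C * w) ^+ 2 +
  (1 - qdot I J) / 2 * Normc.normc (z - 'i%C * w) ^+ 2.
Proof.
move=> /unit_imagE[I0 I1] /unit_imagE[J0 J1]; rewrite !sqr_normc.
case: I J I0 I1 J0 J1 z w => i0 i1 i2 i3 [j0 j1 j2 j3] /= -> NI -> NJ.
move=> [z0 z1] [w0 w1]; rewrite /qnorm2 /=.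
set d := qdot _ _; rewrite /qdot /= in NI NJ.
(* The squared lengths of [I] and [J] are kept as factors, so that this is a polynomial identity
   before they are set to 1. *)
transitivity (z0 ^+ 2 - 2 * z0 * w1 * d + z1 ^+ 2 * (i1 * i1 + i2 * i2 + i3 * i3)
  + w0 ^+ 2 * (j1 * j1 + j2 * j2 + j3 * j3) + 2 * z1 * w0 * d
  + w1 ^+ 2 * ((i1 * i1 + i2 * i2 + i3 * i3) * (j1 * j1 + j2 * j2 + j3 * j3))).
  by rewrite /d /qdot /=; ring.
by rewrite NI NJ; field.
Qed.

(** A metric form of the representation formula: the sums over [Re (z^l)] and [Im (z^l)] recombine
    to [p] at [z] and at its conjugate. *)
Lemma qnorm2_eval I J P p z : unit_imag I -> unit_imag J -> represents I P p ->
  qnorm2 (speval P (qC J z)) =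
  (1 + qdot I J) / 2 * Normc.normc p.[z] ^+ 2 +
  (1 - qdot I J) / 2 * Normc.normc p.[z^*%C] ^+ 2.
Proof.
move=> uI uJ Pp; rewrite /speval.
have -> : [seq qmul (qpow (qC J z) l) (coef P l) | l <- iota 0 (size P)] =
    [seq qmul (qC J (z ^+ l)) (qC I p`_l) | l <- iota 0 (size P)].
  by apply: eq_map => l; rewrite qC_pow// Pp.
rewrite qsum_split qnorm2_split//.
have pE y : p.[y] = \sum_(l <- iota 0 (size P)) y ^+ l * p`_l.
  rewrite (@horner_coef_wide _ (size P)); last first.
    by apply/leq_sizeP => j; exact: represents_size uI Pp.
  rewrite -(big_mkord xpredT (fun j => p`_j * y ^+ j)) /index_iota subn0.
  by apply: eq_bigr => l _; rewrite mulrC.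
congr (_ * Normc.normc _ ^+ 2 + _ * Normc.normc _ ^+ 2).
  rewrite pE mulr_sumr -big_split; apply: eq_bigr => l _ /=.
  by rewrite mulrA -mulrDl -complexE.
rewrite pE mulr_sumr -sumrN -big_split; apply: eq_bigr => l _ /=.
rewrite mulrA -mulNr -mulrDl -rmorphXn /=; congr (_ * _).
case: (z ^+ l) => a b; apply/eqP; rewrite eq_complex /=.
by apply/andP; split; apply/eqP; ring.
Qed.

End Quaternions.

(** * Convergence of the means *)

Section MeasurableQuat.
Context {R : realType} {d : measure_display} {T : measurableType d}.
Implicit Types (f g : T -> quat R) (h : T -> R).

Definition measurable_quat f :=
  [/\ measurable_fun setT (fun x => q0 (f x)),
      measurable_fun setT (fun x => q1 (f x)),
      measurable_fun setT (fun x => q2 (f x)) &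
      measurable_fun setT (fun x => q3 (f x))].

Lemma measurable_qcst (a : quat R) : measurable_quat (fun=> a).
Proof. by split; exact: measurable_cst. Qed.

Lemma measurable_qadd f g : measurable_quat f -> measurable_quat g ->
  measurable_quat (fun x => qadd (f x) (g x)).
Proof. by move=> [? ? ? ?] [? ? ? ?]; split=> /=; exact: measurable_funD. Qed.

Lemma measurable_qmul f g : measurable_quat f -> measurable_quat g ->
  measurable_quat (fun x => qmul (f x) (g x)).
Proof.
move=> [? ? ? ?] [? ? ? ?]; split=> /=;
by repeat first [apply: measurable_funB | apply: measurable_funD
                | apply: measurable_funM].
Qed.

Lemma measurable_qnorm2 f : measurable_quat f ->
  measurable_fun setT (fun x => qnorm2 (f x)).
Proof. by move=> [? ? ? ?]; repeat apply: measurable_funD; apply: measurable_funX. Qed.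

Lemma measurable_qabs f : measurable_quat f ->
  measurable_fun setT (fun x => qabs (f x)).
Proof.
move=> mf; apply: (measurableT_comp (f := @Num.sqrt R)); last exact: measurable_qnorm2.
by apply: continuous_measurable_fun; exact: sqrt_continuous.
Qed.

Lemma measurable_ln_comp h : measurable_fun setT h ->
  measurable_fun setT (fun x => ln (h x)).
Proof. by move=> mh; apply: (measurableT_comp (f := @ln R)). Qed.

Lemma measurable_qinv f : measurable_quat f ->
  measurable_quat (fun x => qinv (f x)).
Proof.
move=> mf; have mn : measurable_fun setT (fun x => (qnorm2 (f x))^-1).
  have -> : (fun x => (qnorm2 (f x))^-1) = (fun x => qnorm2 (f x) `^ (-1)).
    by apply/funext => x; rewrite powR_inv1// qnorm2_ge0.
  apply: (measurableT_comp (f := fun x : R => x `^ (-1))).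
    exact: measurable_powR.
  exact: measurable_qnorm2.
by case: mf => ? ? ? ?; split=> /=; apply: measurable_funM => //;
  apply: measurable_funN.
Qed.

Lemma measurable_qpow f n : measurable_quat f ->
  measurable_quat (fun x => qpow (f x) n).
Proof.
move=> mf; elim: n => [|n IH] /=; first exact: measurable_qcst.
exact: measurable_qmul.
Qed.

Lemma measurable_speval f (P : spoly R) : measurable_quat f ->
  measurable_quat (fun x => speval P (f x)).
Proof.
move=> mf; rewrite /speval; elim: (iota _ _) => [|l s IH] /=.
  exact: measurable_qcst.
apply: measurable_qadd => //; apply: measurable_qmul; last exact: measurable_qcst.
exact: measurable_qpow.
Qed.

Lemma measurable_starpow_neg f (P : spoly R) m : measurable_quat f ->
  measurable_quat (fun x => starpow_neg P m (f x)).
Proof.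
move=> mf; apply: measurable_qmul; last exact: measurable_speval.
by apply/measurable_qinv/measurable_qpow/measurable_speval.
Qed.

End MeasurableQuat.

Section MeasurableHsph.
Variable R : realType.

Lemma measurable_hsph :
  measurable_quat (fun x : R * R * R => hsph x.1.1 x.1.2 x.2).
Proof.
have m1 : measurable_fun setT (fun x : R * R * R => x.1.1).
  exact: (measurableT_comp measurable_fst measurable_fst).
have m2 : measurable_fun setT (fun x : R * R * R => x.1.2).
  exact: (measurableT_comp measurable_snd measurable_fst).
have m3 : measurable_fun setT (fun x : R * R * R => x.2) by exact: measurable_snd.
have ms := measurable_sin R; have mc := measurable_cos R.
by split=> /=; repeat first [apply: measurable_funM
  | apply: (measurableT_comp ms) | apply: (measurableT_comp mc)].
Qed.

Lemma measurable_qexpI (I : quat R) : measurable_quat (qexpI I).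
Proof.
have ms := measurable_sin R; have mc := measurable_cos R.
split=> /=; apply: measurable_funD => //; exact: measurable_funM.
Qed.

End MeasurableHsph.

(** * Pointwise logarithmic estimates and the limit of Haar means *)

Section Limit.
Variable R : realType.
Local Notation mu := (@lebesgue_measure R).
Local Notation D1 := (`[(0 : R), pi] : set R).
Implicit Types (I J : quat R).

(** The direction [J] of the point [cos psi + J sin psi] with angles [psi], [th], [phi]. *)
Definition hdir (th phi : R) : quat R :=
  Quat 0 (cos th) (sin th * cos phi) (sin th * sin phi).

Lemma unit_imag_hdir th phi : unit_imag (hdir th phi).
Proof.
split=> //; rewrite /qnorm2 /= expr0n add0r !exprMn -addrA -mulrDr.
by rewrite cos2Dsin2 mulr1 cos2Dsin2.
Qed.

Lemma hsphE psi th phi : hsph psi th phi = qC R (hdir th phi) (expi R psi).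
Proof. by apply: quat_eq; rewrite /= ?mulr0 ?addr0 ?add0r// mulrA. Qed.

Lemma qexpIE I t : qexpI I t = qC R I (expi R t).
Proof. by []. Qed.

Lemma expiN t : expi R (- t) = (expi R t)^*%C.
Proof. by rewrite /expi cosN sinN. Qed.

(** With [c = <I, J>], [s (1 - s) = (1 - c) (1 + c) / 4]. By the spherical triangle inequality [c]
    lies between [cos (th + th0)] and [cos (th - th0)], and [1 - cos u >= (sin u)^2 / 2]. *)
Lemma qdot_hdir_bound I : unit_imag I -> exists g : R -> R, prod_bounded R g /\
  forall th phi, D1 th -> let s := (1 + qdot R I (hdir th phi)) / 2 in
  g th <= s * (1 - s).
Proof.
move=> /unit_imagE[_]; case: I => i0 i1 i2 i3; rewrite /qdot /= => N.
have i1_le1 : -1 <= i1 <= 1.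
  have : i1 ^+ 2 <= 1 by rewrite expr2 -N -addrA lerDl addr_ge0// -expr2 sqr_ge0.
  by rewrite -ler_norml -[i1 ^+ 2]real_normK ?num_real// expr_le1.
pose th0 := acos i1.
have th0I : 0 <= th0 <= pi by rewrite acos_ge0 ?acos_lepi.
have c0 : cos th0 = i1 by rewrite acosK ?in_itv.
have s0 : 0 <= sin th0 by rewrite sin_ge0_pi.
have s02 : sin th0 ^+ 2 = i2 * i2 + i3 * i3 by rewrite sin2cos2 c0 -N expr2; ring.
(* The angle [pi - th0] replaces [- th0], which changes the sine only in sign and keeps the angle in
   [[0, pi]]. *)
pose g th := 16^-1 * ((`|sin (th - th0)| * `|sin (th - th0)|) *
  (`|sin (th - (pi - th0))| * `|sin (th - (pi - th0))|)).
have th0I' : 0 <= pi - th0 <= pi by apply/andP; move/andP: th0I => [? ?]; split; lra.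
exists g; split.
  apply: prod_bounded_mul; first exact: prod_bounded_cst.
  by do 2 apply: prod_bounded_mul; exact: prod_bounded_sin.
move=> th phi; rewrite /= in_itv/= => thI; have sth := sin_ge0_pi thI.
set X := i2 * cos phi + i3 * sin phi.
(* Cauchy-Schwarz in the plane, [sin th0] being the length of [(i2, i3)]. *)
have XB : `|X| <= sin th0.
  rewrite -[leRHS]ger0_norm// -ler_sqr ?nnegrE// !real_normK ?num_real// s02 /X.
  have := cos2Dsin2 phi; move: (cos phi) (sin phi) => c s cs.
  rewrite -[leRHS]mulr1 -cs; have := sqr_ge0 (i2 * s - i3 * c); nra.
set c := i1 * cos th + i2 * (sin th * cos phi) + i3 * (sin th * sin phi).
have cE : c = i1 * cos th + sin th * X by rewrite /c /X; ring.
move: XB; rewrite ler_norml => /andP[X1 X2].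
have c1 : c <= cos (th - th0).
  by rewrite cE cosB c0 mulrC lerD2l ler_wpM2l.
have c2 : - cos (th - (pi - th0)) <= c.
  have -> : - cos (th - (pi - th0)) = cos (th + th0).
    rewrite -[th + th0](subrK pi) cosDpi; congr (- cos _); ring.
  by rewrite cosD c0 cE; have := ler_wpM2l sth X1; lra.
have half (u : R) : sin u ^+ 2 / 2 <= 1 - cos u.
  by rewrite sin2cos2; have := cos_le1 u; have := sqr_ge0 (1 - cos u); nra.
have -> : (1 + c) / 2 * (1 - (1 + c) / 2) = 4^-1 * ((1 - c) * (1 + c)) by field.
rewrite /g -!expr2 !real_normK ?num_real//.
have h1 : sin (th - th0) ^+ 2 / 2 <= 1 - c by have := half (th - th0); lra.
have h2 : sin (th - (pi - th0)) ^+ 2 / 2 <= 1 + c.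
  by have := half (th - (pi - th0)); lra.
have := ler_pM _ _ h1 h2; rewrite !divr_ge0 ?sqr_ge0// => /(_ isT isT).
by move: (sin _ ^+ 2) (sin _ ^+ 2) => x y; lra.
Qed.

(** Both weights are at least [g], so [x^2] lies between [g M^{2n}] and [M^{2n}] with
    [M = max (A, B)]; take logarithms. *)
Lemma ln_mean_bound (A B s g x : R) n :
  0 < A -> 0 < B -> 0 < g <= s * (1 - s) -> 0 <= x ->
  x ^+ 2 = s * (A ^+ n) ^+ 2 + (1 - s) * (B ^+ n) ^+ 2 ->
  `|ln x - n%:R * ln (Num.max A B)| <= `|ln g|.
Proof.
move=> A0 B0 /andP[g0 gs] x0 xE; set M := Num.max A B.
have M0 : 0 < M by rewrite lt_max A0.
have le_M y : 0 < y -> y <= M -> (y ^+ n) ^+ 2 <= (M ^+ n) ^+ 2.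
  by move=> y0 yM; rewrite -!exprM lerXn2r// nnegrE ltW.
have AM : (A ^+ n) ^+ 2 <= (M ^+ n) ^+ 2 by apply: le_M => //; rewrite le_max lexx.
have BM : (B ^+ n) ^+ 2 <= (M ^+ n) ^+ 2.
  by apply: le_M => //; rewrite le_max lexx orbT.
have An0 : 0 <= (A ^+ n) ^+ 2 by exact: sqr_ge0.
have Bn0 : 0 <= (B ^+ n) ^+ 2 by exact: sqr_ge0.
have Mn0 : 0 < (M ^+ n) ^+ 2 by rewrite !exprn_gt0.
have [s0 s1] : 0 < s /\ 0 < 1 - s by split; nra.
have g1 : g <= 1 by nra.
have gs0 : g <= s by nra.
have gs1 : g <= 1 - s by nra.
have up : x ^+ 2 <= (M ^+ n) ^+ 2 by rewrite xE; nra.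
have lo : g * (M ^+ n) ^+ 2 <= x ^+ 2.
  rewrite xE /M; case: (leP A B) => _; nra.
have xp : 0 < x.
  rewrite lt_neqAle x0 andbT eq_sym; apply/eqP => x00.
  by move: lo; rewrite x00 expr0n /= leNgt mulr_gt0.
have lnx : ln (x ^+ 2) = 2 * ln x by rewrite lnXn// mulr_natl.
have lnM_ : ln ((M ^+ n) ^+ 2) = 2 * (n%:R * ln M).
  by rewrite lnXn ?exprn_gt0// lnXn// !mulr_natl.
have l1 : ln (x ^+ 2) <= ln ((M ^+ n) ^+ 2) by rewrite ler_ln ?posrE ?exprn_gt0.
have l2 : ln g + ln ((M ^+ n) ^+ 2) <= ln (x ^+ 2).
  by rewrite -lnM ?posrE// ler_ln ?posrE ?mulr_gt0 ?exprn_gt0.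
have lg : ln g <= 0 by rewrite ln_le0.
rewrite (ler0_norm lg) ler_norml; rewrite lnx lnM_ in l1 l2.
by apply/andP; split; lra.
Qed.

(** The first alternative absorbs the zeros of [h], where [ln] takes the value 0 and a bound on it
    would say nothing. *)
Definition dominates (K : R -> \bar R) (h : R -> R) := forall t, D1 t ->
  K t = +oo%E \/ (0 < h t /\ (`|ln (h t)|%:E <= K t)%E).

Lemma prod_bounded_dominated (h : R -> R) : prod_bounded R h ->
  exists K : R -> \bar R, [/\ measurable_fun setT K, forall t, (0 <= K t)%E,
    (\int[mu]_(t in D1) K t < +oo)%E & dominates K h].
Proof.
move=> [cs [k [B [k0 kB]]]].
exists (fun t => (`|ln k| + `|ln B|)%:E + log_sings R cs t)%E.
have mS := measurable_log_sings R cs.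
have S0 := log_sings_ge0 R cs.
have C0 : (0 <= (`|ln k| + `|ln B|)%:E)%E by rewrite lee_fin addr_ge0.
split.
- exact: emeasurable_funD.
- by move=> t; rewrite adde_ge0.
- rewrite ge0_integralD//; last exact: measurable_funTS.
  rewrite integral_cst// lebesgue_measure_itv0 ?pi_gt0//.
  by rewrite lte_add_pinfty -?EFinM ?ltry// integral_log_sings.
- move=> t Dt; have := norm_ln_le_log_sings R cs t k B (h t) k0 (kB t Dt).
  by case=> [|->]; [right|left; rewrite addey].
Qed.

Section Mixture.
Variables (I : quat R) (F : nat -> quat R -> R) (A B L : R -> R) (K : R -> \bar R).
Hypothesis uI : unit_imag I.
Hypothesis mF : forall n,
  measurable_fun setT (fun x : R * R * R => ln (F n (hsph x.1.1 x.1.2 x.2))).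
Hypothesis mL : measurable_fun setT L.
Hypothesis mK : measurable_fun setT K.
Hypothesis K0 : forall t, (0 <= K t)%E.
Hypothesis iK : (\int[mu]_(t in D1) K t < +oo)%E.
Hypothesis KA : dominates K A.
Hypothesis KB : dominates K B.
(** Stated for positive values because [- ln (min (a, b))] and the logarithm of the larger inverse
    can differ at a zero, where [0^-1 = 0]. *)
Hypothesis LE : forall t, 0 < A t -> 0 < B t -> L t = ln (Num.max (A t) (B t)).
Hypothesis F0 : forall n x, 0 <= F n x.
Hypothesis FE : forall n psi th phi, 0 < A psi -> 0 < B psi ->
  let s := (1 + qdot R I (hdir th phi)) / 2 in
  F n (hsph psi th phi) ^+ 2 =
    s * (A psi ^+ n) ^+ 2 + (1 - s) * (B psi ^+ n) ^+ 2.

Lemma mixture_dominated t : D1 t -> (`|L t|%:E <= K t)%E.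
Proof.
move=> Dt; case: (KA _ Dt) => [->|[A0 lA]]; first exact: leey.
case: (KB _ Dt) => [->|[B0 lB]]; first exact: leey.
by rewrite LE//; case: (leP (A t) (B t)).
Qed.

(** Serves both limits, with [A] and [B] the two moduli or their inverses. Where a majorant is
    infinite the estimate is trivial; elsewhere the error is at most [|ln (g th)|]. *)
Lemma haar_int_mixture :
  (fun n => n%:R^-1 * haar_int (fun x => ln (F n x))) @ \oo -->
  2 / pi * Rintegral mu D1 (fun t => L t * sin t ^+ 2).
Proof.
have [g [gb gs]] := qdot_hdir_bound _ uI.
have [K2 [mK2 K20 iK2 gK2]] := prod_bounded_dominated _ gb.
apply: (haar_int_mean _ (fun n x => ln (F n x)) L K K2) => //.
  exact: mixture_dominated.
move=> n psi th phi Dpsi Dth.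
have infL : K psi = +oo%E -> (K psi + K2 th = +oo)%E.
  by move=> ->; rewrite addye// gt_eqF// (lt_le_trans _ (K20 th)).
case: (gK2 th Dth) => [->|[g0 lg]].
  by rewrite addey ?leey// gt_eqF// (lt_le_trans _ (K0 psi)).
case: (KA _ Dpsi) => [/infL->|[A0 _]]; first exact: leey.
case: (KB _ Dpsi) => [/infL->|[B0 _]]; first exact: leey.
rewrite LE//; apply: (@le_trans _ _ (K2 th)); last by rewrite leeDr.
apply: le_trans lg; rewrite lee_fin.
apply: (ln_mean_bound _ _ ((1 + qdot R I (hdir th phi)) / 2)) => //.
  by apply/andP; split=> //; exact: gs.
exact: FE.
Qed.

End Mixture.

End Limit.

(** * The limits for positive and negative star powers *)

Theorem theorem5p4 (R : realType) (I : quat R) (P : spoly R) :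
  unit_imag I ->
  (forall l, in_CI I (coef P l)) ->
  spnonzero P ->
  ((fun n : nat => n%:R^-1 * mH (speval (starpow P n))) @ \oo -->
     (2 / pi) * Rintegral (@lebesgue_measure R) `[0, pi] (fun t =>
        ln (Num.max (qabs (speval P (qexpI I t))) (qabs (speval P (qexpI I (- t)))))
        * sin t ^+ 2))
  /\
  ((fun m : nat => (- (m%:R))^-1 * mH (starpow_neg P m)) @ \oo -->
     (2 / pi) * Rintegral (@lebesgue_measure R) `[0, pi] (fun t =>
        ln (Num.min (qabs (speval P (qexpI I t))) (qabs (speval P (qexpI I (- t)))))
        * sin t ^+ 2)).
Proof.
move=> uI PI [l0 Pl0]; have [p Pp] := in_CI_represents _ _ _ uI PI.
have p0 : p != 0.
  by apply/eqP => p0; apply: Pl0; rewrite Pp p0 coef0 qC0.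
pose a t := qabs (speval P (qexpI I t)).
pose b t := qabs (speval P (qexpI I (- t))).
have aE t : a t = Normc.normc p.[expi R t].
  by rewrite /a qexpIE (represents_eval _ _ _ _ _ uI Pp) qabs_qC.
have bE t : b t = Normc.normc p.[(expi R t)^*%C].
  by rewrite /b qexpIE expiN (represents_eval _ _ _ _ _ uI Pp) qabs_qC.
have ba : prod_bounded R a.
  have := prod_bounded_poly _ _ p0; congr prod_bounded.
  by apply/funext => t; rewrite aE.
have bb : prod_bounded R b.
  have := prod_bounded_poly_conj _ _ p0; congr prod_bounded.
  by apply/funext => t; rewrite bE.
have ma : measurable_fun setT a.
  exact/measurable_qabs/measurable_speval/measurable_qexpI.
have mb : measurable_fun setT b.
  by apply: (measurableT_comp ma); exact: oppr_measurable.
have [Ka [mKa Ka0 iKa dKa]] := prod_bounded_dominated _ a ba.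
have [Kb [mKb Kb0 iKb dKb]] := prod_bounded_dominated _ b bb.
pose K t := (Ka t + Kb t)%E.
have mK : measurable_fun setT K by exact: emeasurable_funD.
have K0 t : (0 <= K t)%E by exact: adde_ge0.
have iK : (\int[lebesgue_measure]_(t in `[0%R, pi]) K t < +oo)%E.
  rewrite ge0_integralD//; [exact: lte_add_pinfty|exact: measurable_funTS..].
have Ka_y t : Ka t = +oo%E -> K t = +oo%E.
  by move=> h; rewrite /K h addye// gt_eqF// (lt_le_trans _ (Kb0 t)).
have Kb_y t : Kb t = +oo%E -> K t = +oo%E.
  by move=> h; rewrite /K h addey// gt_eqF// (lt_le_trans _ (Ka0 t)).
have dKA : dominates R K a.
  move=> t Dt; case: (dKa t Dt) => [/Ka_y|[h1 h2]]; [by left|right].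
  by split=> //; apply: (le_trans h2); rewrite leeDl.
have dKB : dominates R K b.
  move=> t Dt; case: (dKb t Dt) => [/Kb_y|[h1 h2]]; [by left|right].
  by split=> //; apply: (le_trans h2); rewrite leeDr.
(* Stated for an arbitrary [Q], to serve the powers of [P], the powers of its conjugate, and the
   symmetrization. *)
have normE psi th phi (q : {poly R[i]}) Q : represents _ I Q q ->
    qabs (speval Q (hsph psi th phi)) ^+ 2 =
    (1 + qdot R I (hdir R th phi)) / 2 * Normc.normc q.[expi R psi] ^+ 2 +
    (1 - (1 + qdot R I (hdir R th phi)) / 2) * Normc.normc q.[(expi R psi)^*%C] ^+ 2.
  move=> Qq; rewrite sqr_qabs hsphE (qnorm2_eval _ _ _ _ _ _ uI _ Qq).
    by congr (_ + _ * _); field.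
  exact: unit_imag_hdir.
have normcX (z : R[i]) n : Normc.normc (z ^+ n) = Normc.normc z ^+ n.
  by elim: n => [|n IH]; rewrite ?expr0 ?Normc.normc1// !exprS Normc.normcM IH.
split.
  apply: (haar_int_mixture _ I
    (fun n x => qabs (speval (starpow P n) x)) a b _ K) => //.
  - move=> n; apply: measurable_ln_comp.
    exact/measurable_qabs/measurable_speval/measurable_hsph.
  - by apply: measurable_ln_comp; exact: measurable_maxr.
  - by move=> n x; exact: qabs_ge0.
  - move=> n psi th phi _ _ /=.
    rewrite (normE _ _ _ (p ^+ n)); last exact: represents_starpow.
    by rewrite !horner_exp !normcX -aE -bE.
(* Inversion only changes the sign of the logarithm, so [K] still serves. *)
have dKA' : dominates R K (fun t => (a t)^-1).
  move=> t Dt; case: (dKA t Dt) => [|[h1 h2]]; [by left|right].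
  by rewrite invr_gt0 lnV ?posrE// normrN.
have dKB' : dominates R K (fun t => (b t)^-1).
  move=> t Dt; case: (dKB t Dt) => [|[h1 h2]]; [by left|right].
  by rewrite invr_gt0 lnV ?posrE// normrN.
have mL : measurable_fun setT (fun t => - ln (Num.min (a t) (b t))).
  by apply/measurable_funN/measurable_ln_comp; exact: measurable_minr.
have LE t : 0 < (a t)^-1 -> 0 < (b t)^-1 ->
    - ln (Num.min (a t) (b t)) = ln (Num.max (a t)^-1 (b t)^-1).
  rewrite !invr_gt0 => at0 bt0.
  by case: (leP (a t) (b t)) => ab; case: (leP (a t)^-1 (b t)^-1) => ab';
    rewrite lnV ?posrE//; congr (- ln _); apply/le_anti;
    move: ab'; rewrite ?ltf_pV2 ?lef_pV2 ?posrE// => ab'; rewrite ?ab ?ab' ?ltW.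
have lim : (fun m => m%:R^-1 * mH (starpow_neg P m)) @ \oo -->
    2 / pi * Rintegral (@lebesgue_measure R) `[0, pi]
      (fun t => - ln (Num.min (a t) (b t)) * sin t ^+ 2).
  apply: (haar_int_mixture _ I (fun m x => qabs (starpow_neg P m x))
    (fun t => (a t)^-1) (fun t => (b t)^-1) _ K) => //.
  - move=> n; apply: measurable_ln_comp.
    exact/measurable_qabs/measurable_starpow_neg/measurable_hsph.
  - by move=> n x; exact: qabs_ge0.
  - move=> m psi th phi; rewrite !invr_gt0 => a0 b0 /=.
    set s := (1 + _) / 2.
    have Pc := represents_conj _ _ _ _ uI Pp; set pc := map_poly _ _ in Pc.
    have pcE z : Normc.normc pc.[z] = Normc.normc p.[z^*%C].
      by rewrite -[in RHS]normc_conjc -horner_map/= conjcK.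
    (* The product [p * pc] has modulus [a b] at both [e^{it}] and [e^{-it}], so the mixture no
       longer depends on [s]. *)
    have symE : qabs (speval (spsym P) (hsph psi th phi)) = a psi * b psi.
      apply/eqP; rewrite -(@eqrXn2 _ 2) ?qabs_ge0 ?mulr_ge0 ?qabs_ge0//.
      rewrite (normE _ _ _ (p * pc)); last exact: represents_star.
      by rewrite !hornerM !Normc.normcM !pcE conjcK -aE -bE; apply/eqP; ring.
    (* The conjugate exchanges [a] and [b]: [(s b^{2m} + (1 - s) a^{2m}) / (a b)^{2m} = s a^{-2m} +
       (1 - s) b^{-2m}]. *)
    rewrite qabs_mul qabs_inv qabs_pow symE !exprMn.
    have := normE psi th phi _ _ (represents_starpow _ _ _ _ m uI Pc).
    rewrite -/s => ->; rewrite !horner_exp !normcX !pcE conjcK -aE -bE !exprVn exprMn.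
    have am0 : a psi ^+ m != 0 by rewrite expf_neq0// gt_eqF.
    have bm0 : b psi ^+ m != 0 by rewrite expf_neq0// gt_eqF.
    by field; rewrite am0 bm0.
have -> : (fun m : nat => (- m%:R)^-1 * mH (starpow_neg P m)) =
    (fun m : nat => - (m%:R^-1 * mH (starpow_neg P m))).
  by apply/funext => m; rewrite invrN mulNr.
(* Integrability is what allows the sign to be moved through the integral. *)
have iL := integrable_mul_sin2 _ _ _ mL mK iK
  (mixture_dominated _ _ _ _ _ dKA' dKB' LE).
rewrite -[X in _ --> X]opprK; apply: cvgN; rewrite -mulrN.
suff -> : - Rintegral (@lebesgue_measure R) `[0, pi]
      (fun t => ln (Num.min (a t) (b t)) * sin t ^+ 2) =
    Rintegral (@lebesgue_measure R) `[0, pi]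
      (fun t => - ln (Num.min (a t) (b t)) * sin t ^+ 2) by exact: lim.
apply/eqP; rewrite eqr_oppLR; apply/eqP; rewrite -mulN1r -RintegralZl//.
by apply: eq_Rintegral => t _; rewrite mulN1r mulNr opprK.
Qed.
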